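(* For each $c\in P$, there exists a unique number $\bar H_\delta(c)\in\mathbb{R}$ for which there is $\bar v^0\in X_\delta$ such that $\varphi_\delta(\bar v^0;c)+\bar H_\delta(c)=\bar v^0$.
   Context: Lagrangian: $\mathbb{T}=\mathbb{R}/\mathbb{Z}$, $\mathbb{T}^d=\mathbb{R}^d/\mathbb{Z}^d$; functions on tori are identified with $1$-periodic functions. $|x|_\infty=\max_j|x^j|$, $|\cdot|$ is the Euclidean norm. $L=L(x,t,\zeta):\mathbb{T}^d\times\mathbb{T}\times\mathbb{R}^d\to\mathbb{R}$ is $C^2$; $L_{\zeta\zeta}$ is positive definite everywhere; for each $a\ge0$ there is $b_1(a)\in\mathbb{R}$ with $L\ge a|\zeta|+b_1(a)$ everywhere; there is $\alpha>0$ with $|L_{x^j}|\le\alpha(1+|L|)$ everywhere ($j=1,\dots,d$). $H(x,t,p)=\sup_{\zeta\in\mathbb{R}^d}(p\cdot\zeta-L(x,t,\zeta))$, $L^{(c)}(x,t,\zeta)=L(x,t,\zeta)-c\cdot\zeta$. $P\subset\mathbb{R}^d$ is a fixed compact convex set and $r>0$ is a fixed number. Grid: $\delta=(h,\tau)$, $h=(2N)^{-1}$, $\tau=(2K)^{-1}$ with $N,K\in\mathbb{N}$, $\lambda=\tau/h$; $x_m=hm$ ($m\in\mathbb{Z}^d$), $t_k=\tau k$ ($k\in\mathbb{Z}$). $G_{\rm even}$ (resp. $G_{\rm odd}$) is the set of $x_m$ with $m^1+\dots+m^d$ even (resp. odd). $\mathcal{G}_\delta=\bigcup_{k}\{(G_{\rm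 even}\times\{t_{2k}\})\cup(G_{\rm odd}\times\{t_{2k+1}\})\}$, $\tilde{\mathcal{G}}_\delta=\bigcup_{k}\{(G_{\rm odd}\times\{t_{2k}\})\cup(G_{\rm even}\times\{t_{2k+1}\})\}$. $e_1,\dots,e_d$ is the standard basis, $B=\{\pm e_1,\dots,\pm e_d\}$. For $v:\tilde{\mathcal{G}}_\delta\to\mathbb{R}$ write $v^k_m=v(x_m,t_k)$ and, for $(x_m,t_k)\in\mathcal{G}_\delta$, $(D_{x^j}v)^k_m=\frac{v^k_{m+e_j}-v^k_{m-e_j}}{2h}$, $D_xv=(D_{x^1}v,\dots,D_{x^d}v)$, $(D_tv)^{k+1}_m=\frac1\tau\big(v^{k+1}_m-\frac1{2d}\sum_{\omega\in B}v^k_{m+\omega}\big)$. For functions on $G_{\rm odd}$, $D_x$ is defined analogously on $G_{\rm even}$. Solution map: $X_\delta$ is the set of functions $w:G_{\rm odd}\to\mathbb{R}$ that are $1$-periodic in each coordinate and satisfy $|D_xw|_\infty\le r$ on $G_{\rm even}$ (identified with their restrictions to one period). For $v^0\in X_\delta$ and $c\in P$, $\varphi^k_\delta(v^0;c)=v(\cdot,t_k)$, $k\ge 0$, where $v$ solves the explicit recursion $(D_tv)^{k+1}_m+H(x_m,t_k,c+(D_xv)^k_m)=0$, $v(\cdot,0)=v^0$. $\varphi_\delta(\cdot;c):=\varphi^{2K}_\delta(\cdot;c)$ is the time-$1$ map. Standing assumption: $r$ is taken large enough and $\delta$ small enough, with $\lambda<\lambda_1$ for a constant $\lambda_1=\lambda_1(r,P)>0$,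 so that for every $c\in P$ and $v^0\in X_\delta$: $\varphi_\delta(\cdot;c)$ maps $X_\delta$ into itself; $|H_p(x_m,t_k,c+(D_xv)^k_m)|_\infty\le(d\lambda_1)^{-1}<(d\lambda)^{-1}$ for all $k\ge0$ and $m$; and $v$ has the stochastic representation $v^{l+1}_n=\inf_\xi E\big[\sum_{0<k\le l+1}L^{(c)}(\gamma^k,t_{k-1},\xi^k_{m(\gamma^k)})\tau+v^0_{m(\gamma^0)}\big]$, where $m(x)$ is the index of a grid point $x$, the infimum is over controls $\xi$ on $\tilde{\mathcal{G}}_\delta$ with values in $[-(d\lambda)^{-1},(d\lambda)^{-1}]^d$, $\gamma$ is the backward random walk with $\gamma^{l+1}=x_n$ jumping from $(x_m,t_{k+1})$ to $(x_m+h\omega,t_k)$ with probability $\frac1{2d}-\frac\lambda2\omega\cdot\xi^{k+1}_m$ ($\omega\in B$), and the minimizing control is $\xi^{*\,k+1}_m=H_p(x_m,t_k,c+(D_xv)^k_m)$. *)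

(* Defs.v *)
From HB Require Import structures.
From mathcomp Require Import all_boot all_order all_algebra.
From mathcomp Require Import all_classical all_reals all_analysis.

Set Implicit Arguments.
Unset Strict Implicit.
Unset Printing Implicit Defensive.

Import Order.TTheory GRing.Theory Num.Theory.
Import numFieldNormedType.Exports.

Local Open Scope classical_set_scope.
Local Open Scope ring_scope.

(* Conventions.
   - Vectors of R^d are row vectors 'rV[R]_d, whose library norm `|x| is the
     sup norm |x|_oo; the Euclidean norm is [enorm].
   - Functions on tori are 1-periodic functions on R^d, resp. R.
   - A grid point (x_m, t_k) is represented by its indices m : 'rV[int]_d and
     k : nat (only times k >= 0 occur).  Functions on G_even, G_odd or
     tilde G_delta are total functions of the indices; every condition on them
     is imposed at the points of the relevant grid only, and their values at
     the remaining indices are irrelevant. *)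

Section Lagrangian.
Variables (R : realType) (d : nat).
Implicit Types (L : 'rV[R]_d -> R -> 'rV[R]_d -> R).
Implicit Types (x c p z u : 'rV[R]_d) (t : R).

Definition dot p z : R := \sum_(j < d) p 0 j * z 0 j.

Definition enorm z : R := Num.sqrt (dot z z).

Definition ebasis (j : 'I_d) : 'rV[R]_d := delta_mx 0 j.

(* On a finite-dimensional space V this is the usual notion: all directional
   (hence all partial) derivatives exist and are continuous. *)
Definition C1 (V : normedModType R) (f : V -> R) : Prop :=
  (forall y, differentiable f y) /\ (forall w, continuous (fun y => 'D_w f y)).

Definition C2 (V : normedModType R) (f : V -> R) : Prop :=
  C1 f /\ (forall w, C1 (fun y => 'D_w f y)).

Definition torus_periodic L : Prop :=
  (forall x t z j, L (x + ebasis j) t z = L x t z) /\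
  (forall x t z, L x (t + 1) z = L x t z).

Definition jointly_C2 L : Prop :=
  C2 (fun y : ('rV[R]_d * R * 'rV[R]_d)%type => L y.1.1 y.1.2 y.2).

Definition hessian (f : 'rV[R]_d -> R) z : 'M[R]_d :=
  \matrix_(i, j) 'D_(ebasis j) (fun y => 'D_(ebasis i) f y) z.

Definition positive_definite (A : 'M[R]_d) : Prop :=
  forall u, u != 0 -> 0 < (u *m A *m u^T) 0 0.

Definition superlinear L : Prop :=
  forall a : R, 0 <= a ->
  exists b1 : R, forall x t z, a * enorm z + b1 <= L x t z.

Definition x_derivative_bound L : Prop :=
  exists2 alpha : R, 0 < alpha & forall x t z (j : 'I_d),
    `|'D_(ebasis j) (fun y => L y t z) x| <= alpha * (1 + `|L x t z|).

Definition Lshift L c x t z : R := L x t z - dot c z.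

(* Real-valued supremum; it is meaningful because the set is bounded above
   when L is superlinear. *)
Definition Ham L x t p : R := sup [set dot p z - L x t z | z in [set: 'rV[R]_d]].

Definition Ham_p L x t p : 'rV[R]_d := \row_j 'D_(ebasis j) (Ham L x t) p.

End Lagrangian.

Section Grid.
Variables (R : realType) (d : nat) (N K : nat).
Notation idx := 'rV[int]_d.
Implicit Types (m n : idx) (k l : nat) (v w : idx -> R) (c : 'rV[R]_d).

Definition hstep : R := (2 * N)%:R^-1.
Definition tstep : R := (2 * K)%:R^-1.
Definition lambda : R := tstep / hstep.

Definition xgrid m : 'rV[R]_d := \row_j (hstep * (m 0 j)%:~R).
Definition tgrid k : R := tstep * k%:R.

Definition on_G m k : bool := (2 %| \sum_(j < d) m 0 j + k%:Z)%Z.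
Definition on_Gtilde m k : bool := ~~ on_G m k.
Definition on_Geven m : bool := (2 %| \sum_(j < d) m 0 j)%Z.
Definition on_Godd m : bool := ~~ on_Geven m.

Definition ibasis (j : 'I_d) : idx := delta_mx 0 j.

(* The set B = {e_1, -e_1, ..., e_d, -e_d} is indexed by 'I_d * bool. *)
Definition jump (b : 'I_d * bool) : idx :=
  if b.2 then ibasis b.1 else - ibasis b.1.

Definition Dx v m : 'rV[R]_d :=
  \row_j ((v (m + ibasis j) - v (m - ibasis j)) / (2 * hstep)).

Definition avg v m : R := (2 * d)%:R^-1 * \sum_b v (m + jump b).

(* [Dt v k m] is (D_t v)^{k+1}_m. *)
Definition Dt (v : nat -> idx -> R) k m : R := tstep^-1 * (v k.+1 m - avg (v k) m).

(* The shift of the index by 2N is the shift of the point x_m by 1. *)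
Definition Xdelta (r : R) : set (idx -> R) :=
  [set w | (forall m j, on_Godd m -> w (m + ibasis j *+ (2 * N)) = w m) /\
           (forall m, on_Geven m -> `|Dx w m| <= r)].

Variable L : 'rV[R]_d -> R -> 'rV[R]_d -> R.

Fixpoint phi c (v0 : idx -> R) k : idx -> R :=
  if k is k'.+1 then
    fun m => avg (phi c v0 k') m
             - tstep * Ham L (xgrid m) (tgrid k') (c + Dx (phi c v0 k') m)
  else v0.

Lemma phi_scheme c v0 k m : (0 < K)%N ->
  Dt (phi c v0) k m + Ham L (xgrid m) (tgrid k) (c + Dx (phi c v0 k) m) = 0.
Proof.
move=> K0; rewrite /Dt /= addrAC subrr add0r mulrN mulKf ?addNr//.
by rewrite /tstep invr_eq0 pnatr_eq0 muln_eq0 /= -lt0n.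
Qed.

Definition time1_map c (v0 : idx -> R) : idx -> R := phi c v0 (2 * K).

Definition control := nat -> idx -> 'rV[R]_d.

Definition admissible : set control :=
  [set xi | forall k m, on_Gtilde m k -> `|xi k m| <= (d%:R * lambda)^-1].

(* A trajectory of the backward walk started at time l+1 is given by its
   jumps: [om i] is the jump made from time i+1 to time i. *)
Definition walk l := {ffun 'I_l.+1 -> 'I_d * bool}.

(* the index of gamma^k when gamma^{l+1} = x_n *)
Definition position l (om : walk l) n k : idx :=
  n + \sum_(i < l.+1 | (k <= i)%N) jump (om i).

Definition jump_prob (xi : control) k m (b : 'I_d * bool) : R :=
  (2 * d)%:R^-1 - lambda / 2 * dot (map_mx intr (jump b)) (xi k.+1 m).

Definition path_prob (xi : control) l n (om : walk l) : R :=
  \prod_(i < l.+1) jump_prob xi i (position om n i.+1) (om i).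

Definition walk_expectation (xi : control) l n (f : walk l -> R) : R :=
  \sum_om path_prob xi n om * f om.

(* The i-th summand is the one with k = i + 1. *)
Definition walk_cost c (v0 : idx -> R) l n (xi : control) : R :=
  walk_expectation xi n (fun om : walk l =>
    \sum_(i < l.+1)
       Lshift L c (xgrid (position om n i.+1)) (tgrid i)
              (xi i.+1 (position om n i.+1)) * tstep
    + v0 (position om n 0)).

(* The walk never uses the value of a control at time 0. *)
Definition optimal_control c (v0 : idx -> R) : control := fun k m =>
  if k is k'.+1 then Ham_p L (xgrid m) (tgrid k') (c + Dx (phi c v0 k') m)
  else 0.

Definition time1_invariant (P : set 'rV[R]_d) (r : R) : Prop :=
  forall c v0, P c -> Xdelta r v0 -> Xdelta r (time1_map c v0).

Definition speed_bound (P : set 'rV[R]_d) (r lambda1 : R) : Prop :=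
  forall c v0 k m, P c -> Xdelta r v0 -> on_G m k ->
    `|Ham_p L (xgrid m) (tgrid k) (c + Dx (phi c v0 k) m)|
      <= (d%:R * lambda1)^-1.

Definition stochastic_representation (P : set 'rV[R]_d) (r : R) : Prop :=
  forall c v0 l n, P c -> Xdelta r v0 -> on_Gtilde n l.+1 ->
    (phi c v0 l.+1 n)%:E
      = ereal_inf [set (walk_cost c v0 l n xi)%:E | xi in admissible] /\
    admissible (optimal_control c v0) /\
    walk_cost c v0 l n (optimal_control c v0) = phi c v0 l.+1 n.

End Grid.

Arguments hstep : clear implicits.
Arguments tstep : clear implicits.
Arguments lambda : clear implicits.

(* Main.v *)
Require Import Defs.
From mathcomp Require Import all_boot all_order all_algebra.
From mathcomp Require Import all_classical all_reals all_analysis.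
From mathcomp Require Import zify ring lra.
Import Order.TTheory GRing.Theory Num.Theory.
Import numFieldNormedType.Exports.
Local Open Scope classical_set_scope.
Local Open Scope ring_scope.

Set Implicit Arguments.
Unset Strict Implicit.
Unset Printing Implicit Defensive.

(** The time-one map [S] is monotone on the odd grid, since the stochastic
    representation makes it an infimum over walks with nonnegative weights,
    and it commutes with the addition of constants. Hence it is nonexpansive
    for the sup norm, and the equation [S v + H = v] is an additive eigenvalue
    problem.

    Uniqueness of the eigenvalue is a comparison at a maximum point of the
    difference of two eigenvectors ([eigenvalue_unique]).

    Existence goes by vanishing discount instead of a fixed point theorem of
    Brouwer type. For small [e > 0] the map [v |-> (1 - e) * S v] is a
    contraction preserving [Xdelta], whose approximate fixed points satisfy
    [S v - v = e / (1 - e) * v] up to an error of order [e]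
    ([discounted_approx]). If the oscillation of [v] is bounded independently
    of [e], the right-hand side is nearly constant, and a limit of the
    normalised functions as [e] tends to [0] is an eigenvector
    ([eigenvalue_exists]).

    The crux is this oscillation bound. The constraint on the discrete gradient
    does not provide it when [d > 1]: centred differences connect only odd
    points whose coordinates have the same parities, so [Xdelta] modulo
    constants is unbounded. The bound comes from the averaging in the scheme.
    The Hamiltonian is bounded below by the negative of the cost of staying at
    rest, so the scheme is dominated by plain averaging up to a constant, and a
    strong maximum principle ([phi_upper]) carries near-maximality from a
    maximum point to all points of the finite odd torus ([harnack]). *)

(** * Parity and periodicity on the index lattice *)

Section Lattice.
Variable d : nat.
Notation idx := 'rV[int]_d.
Implicit Types (m n q : idx) (b : 'I_d * bool).

Lemma on_GevenD m n : on_Geven (m + n) = (on_Geven m == on_Geven n).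
Proof.
rewrite /on_Geven; under eq_bigr do rewrite mxE.
rewrite big_split /=; move: (\sum_j m 0 j) (\sum_j n 0 j) => a b; lia.
Qed.

Lemma on_GevenN m : on_Geven (- m) = on_Geven m.
Proof.
rewrite /on_Geven; under eq_bigr do rewrite mxE.
by rewrite sumrN; move: (\sum_j _) => a; lia.
Qed.

Lemma on_Geven_ibasis j : on_Geven (ibasis j : idx) = false.
Proof.
rewrite /on_Geven (bigD1 j) //= big1 => [|i /negPf ij]; last by rewrite mxE ij.
by rewrite mxE !eqxx.
Qed.

Lemma on_Geven_jump b : on_Geven (jump b) = false.
Proof. by rewrite /jump; case: ifP; rewrite ?on_GevenN on_Geven_ibasis. Qed.

Lemma on_GE m k : on_G m k = (on_Geven m == ~~ odd k).
Proof. by rewrite /on_G /on_Geven; move: (\sum_j _) => a; lia. Qed.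

Lemma on_Gtilde_jump m k b : on_Gtilde (m + jump b) k = on_Gtilde m k.+1.
Proof.
by rewrite /on_Gtilde !on_GE on_GevenD on_Geven_jump /=; case: on_Geven; case: odd.
Qed.

Lemma on_Gtilde_even m k : ~~ odd k -> on_Gtilde m k = on_Godd m.
Proof. by rewrite /on_Gtilde on_GE /on_Godd => ->; case: on_Geven. Qed.

Lemma lattice_ind (S : idx -> Prop) :
  S 0 -> (forall m n, S m -> S n -> S (m + n)) -> (forall m, S m -> S (- m)) ->
  (forall j, S (ibasis j)) -> forall m, S m.
Proof.
move=> S0 SD SN Sb m.
have Snat n k : S n -> S (n *+ k).
  by move=> Sn; elim: k => [//|k IH]; rewrite mulrS; exact: SD.
rewrite [m]row_sum_delta; elim/big_ind : _ => //= j _.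
have -> : m 0 j *: delta_mx 0 j = ibasis j *~ m 0 j by rewrite -scaler_int intz.
by case: (m 0 j) => k; [exact: Snat|rewrite NegzE mulrNz; apply: SN; exact: Snat].
Qed.

Definition opp_jump b := (b.1, ~~ b.2).

Lemma jump_opp_jump b : jump (opp_jump b) = - jump b.
Proof. by rewrite /jump /opp_jump /=; case: b => j [] /=; rewrite ?opprK. Qed.

Definition displacement (s : seq ('I_d * bool)) : idx := \sum_(b <- s) jump b.

Lemma displacement_surj q : exists s, displacement s = q.
Proof.
rewrite /displacement; elim/lattice_ind: q.
- by exists [::]; rewrite big_nil.
- by move=> m n [s <-] [t <-]; exists (s ++ t); rewrite big_cat.
- move=> m [s <-]; exists (map opp_jump s); rewrite big_map -sumrN.
  by apply: eq_bigr => b _; exact: jump_opp_jump.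
- by move=> j; exists [:: (j, true)]; rewrite big_seq1.
Qed.

Lemma on_Geven_displacement s : on_Geven (displacement s) = ~~ odd (size s).
Proof.
elim: s => [|b s IH].
  by rewrite /displacement big_nil /on_Geven big1 // => j; rewrite mxE.
rewrite /displacement big_cons on_GevenD on_Geven_jump -/(displacement s) IH /=.
by case: odd.
Qed.

Lemma displacement_cat s t :
  displacement (s ++ t) = displacement s + displacement t.
Proof. by rewrite /displacement big_cat. Qed.

(** A path can be lengthened by going back and forth along one edge. *)
Lemma displacement_pad b j : exists2 s,
  displacement s = 0 & size s = (2 * j)%N.
Proof.
exists (flatten (nseq j [:: b; opp_jump b])); last first.
  by rewrite size_flatten /shape map_nseq sumn_nseq /=.
elim: j => [|j IH] /=; first by rewrite /displacement big_nil.
rewrite (displacement_cat [:: _; _]) IH /displacement big_cons big_seq1.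
by rewrite jump_opp_jump addr0 subrr.
Qed.

(** Even vectors are reached in a whole number of periods of the scheme, one
    period being [2 * K] jumps, because a path of even length [2 * k] can be
    padded to length [k * (2 * K)]. *)
Lemma displacement_blocks K q : (0 < d)%N -> (0 < K)%N -> on_Geven q ->
  exists s k, displacement s = q /\ size s = (k * (2 * K))%N.
Proof.
move=> d0 K0; have [s <-] := displacement_surj q.
rewrite on_Geven_displacement => es.
have [t t0 st] := displacement_pad (Ordinal d0, true) ((size s)./2 * (K - 1)).
exists (s ++ t), (size s)./2; rewrite displacement_cat t0 addr0; split => //.
rewrite size_cat st -{1}(odd_double_half (size s)) (negPf es) -muln2; nia.
Qed.

Variable N : nat.
Hypothesis N_gt0 : (0 < N)%N.

(** A fundamental domain for the translations by [2 * N] in each coordinate;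
    it makes suprema of periodic grid functions finite maxima. *)
Definition residue := {ffun 'I_d -> 'I_(2 * N)}.
Definition rep (t : residue) : idx := \row_j (t j : nat)%:Z.

Lemma rep_surj m : exists t q, m = rep t + q *+ (2 * N).
Proof.
have lt (j : 'I_d) : (`|(m 0%R j %% (2 * N)%:Z)%Z| < 2 * N)%N.
  have := @ltz_pmod (m 0 j) (2 * N)%:Z.
  by have := modz_ge0 (m 0 j) (_ : (2 * N)%:Z != 0); lia.
exists [ffun j => Ordinal (lt j)], (\row_j (m 0%R j %/ (2 * N)%:Z)%Z).
apply/rowP => j; rewrite !mxE ffunE /= mulmxnE mxE.
have := modz_ge0 (m 0 j) (_ : (2 * N)%:Z != 0) => H.
rewrite gez0_abs ?H //; last by lia.
by rewrite addrC -mulr_natr natz {1}(divz_eq (m 0 j) (2 * N)%:Z).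
Qed.

Lemma periodic_shift (A : Type) (f : idx -> A) :
  (forall m j, f (m + ibasis j *+ (2 * N)) = f m) ->
  forall m q, f (m + q *+ (2 * N)) = f m.
Proof.
move=> fP m q; move: q m; apply: lattice_ind.
- by move=> m; rewrite mul0rn addr0.
- by move=> p q fp fq m; rewrite mulrnDl addrA fq fp.
- by move=> q fq m; rewrite -[LHS]fq mulNrn subrK.
- by [].
Qed.

(** The representative is chosen before [f], so that one representative serves
    both the parity and a grid function. *)
Lemma periodic_rep m : exists t, forall (A : Type) (f : idx -> A),
  (forall m j, f (m + ibasis j *+ (2 * N)) = f m) -> f m = f (rep t).
Proof.
have [t [q ->]] := rep_surj m.
by exists t => A f fP; rewrite periodic_shift.
Qed.

Lemma on_Godd_shift m j : on_Godd (m + ibasis j *+ (2 * N)) = on_Godd m.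
Proof.
rewrite /on_Godd on_GevenD; congr (~~ _).
suff -> : on_Geven (ibasis j *+ (2 * N)) by case: on_Geven.
by rewrite mulnC mulrnA mulr2n on_GevenD eqxx.
Qed.

Definition odd_periodic (A : Type) (v : idx -> A) :=
  forall m j, on_Godd m -> v (m + ibasis j *+ (2 * N)) = v m.

Lemma odd_periodic_rep m : on_Godd m -> exists2 t, on_Godd (rep t) &
  forall (A : Type) (v : idx -> A), odd_periodic v -> v m = v (rep t).
Proof.
move=> om; have [t tP] := periodic_rep m; exists t.
  by rewrite -(tP _ (@on_Godd d)) // => n j; exact: on_Godd_shift.
move=> A v vP.
(* [f] extends [v] off the odd sublattice to a function periodic everywhere. *)
pose f n := if on_Godd n then v n else v m.
have : f m = f (rep t).
  by apply: tP => n j; rewrite /f on_Godd_shift; case: ifP => // /vP.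
by rewrite /f om -(tP _ (@on_Godd d)) ?om // => n j; exact: on_Godd_shift.
Qed.

Lemma odd_bounded (R : realType) (v : idx -> R) : odd_periodic v ->
  exists B, forall m, on_Godd m -> `|v m| <= B.
Proof.
move=> vP; exists (\sum_t `|v (rep t)|) => m /odd_periodic_rep [t _ ->//].
by rewrite (bigD1 t) //= lerDl sumr_ge0.
Qed.

Lemma odd_argmax (R : realType) (v : idx -> R) : (0 < d)%N -> odd_periodic v ->
  exists t, on_Godd (rep t) /\ forall m, on_Godd m -> v m <= v (rep t).
Proof.
move=> d0 vP.
have oj : on_Godd (ibasis (Ordinal d0)) by rewrite /on_Godd on_Geven_ibasis.
have [t0 t0o _] := odd_periodic_rep oj.
case: (@Order.TotalTheory.arg_maxP _ _ _ t0 (fun t => on_Godd (rep t))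
  (fun t => v (rep t)) t0o) => t to tmax.
by exists t; split => // m /odd_periodic_rep [t' t'o ->//]; exact: tmax.
Qed.

End Lattice.

(** * The difference scheme bounded from above *)

Section Scheme.
Variables (R : realType) (d N K : nat).
Hypotheses (d_gt0 : (0 < d)%N) (N_gt0 : (0 < N)%N) (K_gt0 : (0 < K)%N).
Variable L : 'rV[R]_d -> R -> 'rV[R]_d -> R.
Notation idx := 'rV[int]_d.
Notation phi := (phi N K L).
Implicit Types (m n : idx) (c : 'rV[R]_d) (v w : idx -> R).

Lemma avg_addr v (a : R) m : avg (fun n => v n + a) m = avg v m + a.
Proof.
rewrite /avg big_split mulrDr /= sumr_const card_prod card_ord card_bool.
rewrite -[a *+ _]mulr_natl mulrA [(d * 2)%N]mulnC mulVf ?mul1r//.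
by rewrite pnatr_eq0 muln_eq0 /= -lt0n.
Qed.

Lemma Dx_addr v (a : R) m : Dx N (fun n => v n + a) m = Dx N v m.
Proof. by apply/rowP => j; rewrite !mxE opprD addrACA subrr addr0. Qed.

Lemma phi_addr c v (a : R) k m : phi c (fun n => v n + a) k m = phi c v k m + a.
Proof.
elim: k m => [//|k IH] m /=.
have -> : phi c (fun n => v n + a) k = fun n => phi c v k n + a by exact: funext.
by rewrite avg_addr Dx_addr addrAC.
Qed.

Definition jump_weight : R := (2 * d)%:R^-1.

Lemma jump_weight_gt0 : 0 < jump_weight.
Proof. by rewrite /jump_weight invr_gt0 ltr0n muln_gt0. Qed.

(** A quantitative strong maximum principle: a gap below the upper bound at
    one neighbour survives in the average, multiplied by [jump_weight]. *)
Lemma avg_gap v (M g : R) m b : (forall b', v (m + jump b') <= M) ->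
  v (m + jump b) <= M - g -> avg v m <= M - jump_weight * g.
Proof.
move=> vM vg.
have -> : avg v m = M + avg (fun n => v n - M) m.
  by rewrite avg_addr addrC subrK.
rewrite lerD2l /avg -mulrN ler_pM2l ?jump_weight_gt0//.
rewrite (bigD1 b) //= -[leRHS]addr0; apply: lerD.
  by rewrite lerBlDl.
by apply: sumr_le0 => b' _; rewrite subr_le0.
Qed.

(** Test the supremum with the velocity [0]; superlinearity makes the set
    bounded above, so that its real supremum is an upper bound. *)
Lemma Ham_ge x t p : superlinear L -> - L x t 0 <= Ham L x t p.
Proof.
move=> Lsl; apply: ub_le_sup; last first.
  exists 0 => //; rewrite /dot big1 ?sub0r// => j _; by rewrite mxE mulr0.
(* The slope dominates the linear term because each coordinate of [z] is at
   most its Euclidean norm. *)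
pose A := \sum_j `|p 0 j|.
have A0 : 0 <= A by exact: sumr_ge0.
have [b1 Lb] := Lsl _ A0.
exists (- b1) => _ [z _ <-].
have zj j : `|z 0 j| <= enorm z.
  rewrite /enorm -sqrtr_sqr ler_wsqrtr// /dot (bigD1 j) //= -expr2 lerDl.
  by apply: sumr_ge0 => i _; rewrite -expr2 sqr_ge0.
suff : dot p z <= A * enorm z by move: (Lb x t z); lra.
rewrite /dot mulr_suml ler_sum// => j _.
by rewrite (le_trans (ler_norm _))// normrM ler_wpM2l.
Qed.

Lemma hstep_period : hstep R N *+ (2 * N) = 1.
Proof.
rewrite /hstep -[X in X = _]mulr_natr mulVf//.
by rewrite pnatr_eq0 muln_eq0 /= -lt0n.
Qed.

(** By [Ham_ge] the increment of one time step is at most the cost of staying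
    at rest, uniformly in the momentum; periodicity leaves finitely many grid
    points to consider. *)
Lemma grid_cost_bounded : torus_periodic L -> superlinear L ->
  exists2 C, 0 <= C & forall c k m, (k < 2 * K)%N ->
    - (tstep R K * Ham L (xgrid R N m) (tgrid R K k) c) <= C.
Proof.
move=> [Lx _] Lsl.
have t0 : 0 <= tstep R K by rewrite invr_ge0 ler0n.
pose F (k : nat) m := `|tstep R K * L (xgrid R N m) (tgrid R K k) 0|.
exists (\sum_(k < 2 * K) \sum_(t : residue d N) F k (rep t)).
  by apply: sumr_ge0 => k _; apply: sumr_ge0 => t _; exact: normr_ge0.
move=> c k m kK.
have [t tP] := @periodic_rep d N N_gt0 m.
have H : F k m = F k (rep t).
  apply: (tP _ (F k)) => n j; rewrite /F; congr (`|_ * _|).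
  have -> : xgrid R N (n + ibasis j *+ (2 * N)) = xgrid R N n + ebasis R j.
    apply/rowP => i; rewrite /ibasis !mxE mulmxnE mxE rmorphD mulrDr rmorphMn /=.
    by rewrite mulrnAr -mulrnAl hstep_period mul1r; case: (i == j).
  exact: Lx.
apply: (@le_trans _ _ (F k m)).
  rewrite -mulrN (le_trans _ (ler_norm _))// ler_wpM2l// lerNl; exact: Ham_ge.
rewrite H (bigD1 (Ordinal kK)) //= (bigD1 t) //= -addrA lerDl addr_ge0//.
  by apply: sumr_ge0 => s _; exact: normr_ge0.
by apply: sumr_ge0 => i _; apply: sumr_ge0 => s _; exact: normr_ge0.
Qed.

(** The strong maximum principle iterated along the path [s]: if [v] lies
    below [M] on the odd grid, then its gap to [M] at the end of the path is
    still felt at the start after [size s] steps. As [C] is uniform in the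
    momentum, so is the estimate in the discrete gradient of [v]. *)
Lemma phi_upper c (C M : R) v (s : seq ('I_d * bool)) m : 0 <= C ->
  (forall p k n, (k < 2 * K)%N ->
    - (tstep R K * Ham L (xgrid R N n) (tgrid R K k) p) <= C) ->
  (forall n, on_Godd n -> v n <= M) -> (size s <= 2 * K)%N ->
  on_Gtilde m (size s) ->
  phi c v (size s) m <=
    M + (size s)%:R * C - jump_weight ^+ size s * (M - v (m + displacement s)).
Proof.
move=> C0 HC vM; elim: s m => [|b s IH] m /= sK om.
  by rewrite /displacement big_nil addr0 mul0r expr0 mul1r addr0 subKr.
have ub n : on_Gtilde n (size s) -> phi c v (size s) n <= M + (size s)%:R * C.
  move=> on; apply: le_trans (IH n (ltnW sK) on) _.
  rewrite gerBl; apply: mulr_ge0; first by rewrite exprn_ge0 ?ltW ?jump_weight_gt0.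
  rewrite subr_ge0 vM//.
  move: on; rewrite /on_Gtilde on_GE /on_Godd on_GevenD on_Geven_displacement.
  by case: on_Geven; case: odd.
have : avg (phi c v (size s)) m <= M + (size s)%:R * C
    - jump_weight * (jump_weight ^+ size s * (M - v (m + displacement (b :: s)))).
  apply: (avg_gap (b := b)) => [b'|].
    by apply: ub; rewrite on_Gtilde_jump.
  rewrite /displacement big_cons addrA; apply: IH; first exact: ltnW.
  by rewrite on_Gtilde_jump.
have := HC (c + Dx N (phi c v (size s)) m) (size s) m sK.
rewrite exprS -mulrA mulrSr mulrDl mul1r; lra.
Qed.

End Scheme.

(** * Monotonicity and oscillation of the time-one map *)

Lemma mx_norm_leP (R : realType) (d : nat) (x : 'rV[R]_d) (a : R) : 0 <= a ->
  `|x| <= a <-> forall j, `|x 0 j| <= a.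
Proof.
move=> a0; rewrite /Num.norm/= mx_normrE; split.
  by move=> /bigmax_leP[_ H] j; exact: (H (0, j)).
by move=> H; apply/bigmax_leP; split => // -[i j] _; rewrite ord1; exact: H.
Qed.

Section TimeOne.
Variables (R : realType) (d N K : nat).
Hypotheses (d_gt0 : (0 < d)%N) (N_gt0 : (0 < N)%N) (K_gt0 : (0 < K)%N).
Variable L : 'rV[R]_d -> R -> 'rV[R]_d -> R.
Notation idx := 'rV[int]_d.
Notation time1_map := (time1_map N K L).
Implicit Types (m n : idx) (c : 'rV[R]_d) (v w : idx -> R).

Lemma lambda_gt0 : 0 < lambda R N K.
Proof.
by rewrite /lambda /tstep /hstep divr_gt0// invr_gt0 ltr0n muln_gt0.
Qed.

Lemma dot_jump (b : 'I_d * bool) (z : 'rV[R]_d) :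
  dot (map_mx intr (jump b)) z = if b.2 then z 0 b.1 else - z 0 b.1.
Proof.
rewrite /dot /jump /ibasis; case: b => j [] /=; rewrite (bigD1 j) //= !mxE !eqxx /=;
  (rewrite big1 => [|i /negPf ij]; last by rewrite !mxE ij ?oppr0 mul0r).
  by rewrite mul1r addr0.
by rewrite rmorphN mulN1r addr0.
Qed.

(** The bound on admissible controls is exactly the one that makes the
    transition weights nonnegative. *)
Lemma jump_prob_ge0 xi k m (b : 'I_d * bool) :
  `|xi k.+1 m| <= (d%:R * lambda R N K)^-1 -> 0 <= jump_prob N K xi k m b.
Proof.
move=> xi_le; have l0 := lambda_gt0.
have d0 : 0 < d%:R :> R by rewrite ltr0n.
have xj : `|xi k.+1 m 0 b.1| <= (d%:R * lambda R N K)^-1.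
  by move/mx_norm_leP: xi_le; apply; rewrite invr_ge0 mulr_ge0// ltW.
rewrite /jump_prob dot_jump subr_ge0.
have -> : (2 * d)%:R^-1 = lambda R N K / 2 * (d%:R * lambda R N K)^-1 :> R.
  by rewrite natrM; field; rewrite !gt_eqF.
rewrite ler_pM2l; last by rewrite pmulr_lgt0 ?invr_gt0.
by move: xj; rewrite ler_norml; case: ifP => _ /andP[]; lra.
Qed.

Lemma position_step l (om : walk d l) n (k : 'I_l.+1) :
  position om n k = position om n k.+1 + jump (om k).
Proof.
rewrite /position (bigD1 k) //= addrA addrAC -!addrA; congr (n + (_ + _)).
by apply: eq_bigl => i; rewrite ltn_neqAle andbC eq_sym.
Qed.

(** The walk alternates parity with time, hence stays on the dual grid, where
    the control is constrained. *)
Lemma position_on_Gtilde l (om : walk d l) n k : (k <= l.+1)%N ->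
  on_Gtilde n l.+1 -> on_Gtilde (position om n k) k.
Proof.
move=> kl on; rewrite -(subKn kl).
elim: (l.+1 - k)%N (leq_subr k l.+1) => [_|j IH jl].
  rewrite subn0 /position big1 ?addr0// => i.
  by rewrite leqNgt ltn_ord.
have lt : (l.+1 - j.+1 < l.+1)%N by lia.
rewrite (position_step om n (Ordinal lt)) on_Gtilde_jump /= -subSn//.
exact: IH (ltnW jl).
Qed.

Lemma walk_cost_le c v w l n xi : admissible N K xi -> on_Gtilde n l.+1 ->
  (forall m, on_Godd m -> v m <= w m) ->
  walk_cost N K L c v l n xi <= walk_cost N K L c w l n xi.
Proof.
move=> xiA on vw; apply: ler_sum => om _; apply: ler_wpM2l.
  apply: prodr_ge0 => i _; apply: jump_prob_ge0; apply: xiA.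
  exact: position_on_Gtilde.
by rewrite lerD2l vw// -(on_Gtilde_even _ (k := 0))//; exact: position_on_Gtilde.
Qed.

Variables (P : set 'rV[R]_d) (r : R).
Hypothesis repr : stochastic_representation N K L P r.
Variable c : 'rV[R]_d.
Hypothesis Pc : P c.

Lemma time1_map_addr v a m :
  time1_map c (fun n => v n + a) m = time1_map c v m + a.
Proof. exact: phi_addr. Qed.

(** The representation writes the map as an infimum of functionals that are
    monotone in the initial datum; the optimal control of the larger datum is
    a competitor for the smaller one. *)
Lemma time1_map_le v w : Xdelta N r v -> Xdelta N r w ->
  (forall m, on_Godd m -> v m <= w m) ->
  forall m, on_Godd m -> time1_map c v m <= time1_map c w m.
Proof.
move=> Xv Xw vw m om.
have om' : on_Gtilde m (2 * K).-1.+1.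
  by rewrite prednK ?muln_gt0// on_Gtilde_even// mul2n odd_double.
rewrite /Defs.time1_map -(prednK (_ : 0 < 2 * K)%N) ?muln_gt0//.
have [_ [xiA <-]] := repr Pc Xw om'.
apply: le_trans (walk_cost_le c xiA om' vw).
rewrite -lee_fin (repr Pc Xv om').1; apply: ereal_inf_lbound.
by exists (optimal_control N K L c w).
Qed.

(** Near-maximality spreads: for a subsolution up to [C], a point within [E]
    of the maximum forces every point reachable in one period to be within a
    bound depending on [C] and [E] only. *)
Lemma harnack_step (C E : R) : torus_periodic L -> superlinear L ->
  exists E' : R, forall v n s, size s = (2 * K)%N ->
   (forall m, on_Godd m -> v m <= time1_map c v m + C) ->
   (forall m, on_Godd m -> v m <= v n) ->
   forall m, on_Godd m -> v n - v m <= E -> v n - v (m + displacement s) <= E'.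
Proof.
move=> Lper Lsl.
have [C0 C0_ge0 HC0] := @grid_cost_bounded R d N K N_gt0 L Lper Lsl.
pose p := jump_weight R d ^+ (2 * K).
have p0 : 0 < p by rewrite exprn_gt0// jump_weight_gt0.
(* Solve the inequality of [phi_upper] for the gap at the end of the path. *)
exists ((E + C + (2 * K)%:R * C0) / p) => v n s ss sub vn m om Em.
rewrite ler_pdivlMr// mulrC.
have := @phi_upper R d N K d_gt0 L c C0 (v n) v s m C0_ge0 HC0 vn.
rewrite ss => /(_ (leqnn _)).
rewrite on_Gtilde_even ?mul2n ?odd_double// -mul2n => /(_ om).
have := sub m om; rewrite /Defs.time1_map -/p; lra.
Qed.

(** A Harnack-type bound on the oscillation. The gradient constraint of
    [Xdelta] cannot give it: for [d > 1] the centred differences do not relate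
    odd points that lie in different classes modulo [2]. It comes from the
    averaging, by repeating [harnack_step] from a maximum point; only finitely
    many increments between representatives have to be reached. *)
Lemma harnack (C : R) : torus_periodic L -> superlinear L ->
  exists D : R, forall v, odd_periodic N v ->
   (forall m, on_Godd m -> v m <= time1_map c v m + C) ->
   forall m m', on_Godd m -> on_Godd m' -> v m - v m' <= D.
Proof.
move=> Lper Lsl.
have steps k : exists E : R, forall v n s, size s = (k * (2 * K))%N ->
    (forall m, on_Godd m -> v m <= time1_map c v m + C) ->
    (forall m, on_Godd m -> v m <= v n) -> on_Godd n ->
    v n - v (n + displacement s) <= E.
  elim: k => [|k [E IH]].
    exists 0 => v n [|//] _ _ _ _.
    by rewrite /displacement big_nil addr0 subrr.
  have [E' HE'] := harnack_step C E Lper Lsl.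
  exists E' => v n s ss sub vn on.
  rewrite -(cat_take_drop (k * (2 * K)) s) displacement_cat addrA.
  have st : size (take (k * (2 * K)) s) = (k * (2 * K))%N.
    by rewrite size_take ss; case: ltnP => //; lia.
  apply: HE' => //.
  - by rewrite size_drop ss mulSn addnK.
  - rewrite /on_Godd on_GevenD on_Geven_displacement st mulnCA oddM /=.
    by move: on; rewrite /on_Godd; case: on_Geven.
  - exact: IH.
have pair (tt : residue d N * residue d N) : exists E,
    on_Godd (rep tt.1) -> on_Godd (rep tt.2) -> forall v,
    (forall m, on_Godd m -> v m <= time1_map c v m + C) ->
    (forall m, on_Godd m -> v m <= v (rep tt.1)) ->
    v (rep tt.1) - v (rep tt.2) <= E.
  case: (boolP (on_Godd (rep tt.1))) => [odd1|/negP odd1]; last by exists 0.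
  case: (boolP (on_Godd (rep tt.2))) => [odd2|/negP odd2]; last by exists 0.
  have e : on_Geven (rep tt.2 - rep tt.1).
    move: odd1 odd2; rewrite on_GevenD on_GevenN /on_Godd.
    by do 2 case: on_Geven.
  have [s [k [sE ss]]] := displacement_blocks d_gt0 K_gt0 e.
  have [E HE] := steps k; exists E => _ _ v sub vmax.
  by have := HE v _ s ss sub vmax odd1; rewrite sE addrC [rep _ + _]addrC subrK addrC.
have [E HE] := choice pair.
exists (\sum_tt `|E tt|) => v vper sub m m' om om'.
have [t [ot tmax]] := odd_argmax N_gt0 d_gt0 vper.
have [t' ot' /(_ _ _ vper) ->] := odd_periodic_rep N_gt0 om'.
apply: (@le_trans _ _ (E (t, t'))).
  apply: le_trans (HE (t, t') ot ot' v sub tmax).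
  by rewrite lerD2r tmax.
rewrite (bigD1 (t, t')) //= (le_trans (ler_norm _))// lerDl.
by apply: sumr_ge0 => i _; exact: normr_ge0.
Qed.

End TimeOne.

(** * Limits of real sequences *)

(** Limits along an ultrafilter exist at all grid points at once, which
    replaces the extraction of a convergent subsequence. *)
Lemma bounded_ultra_cvg (R : realType) (T : Type) (G : set_system T) (D : R)
    (f : T -> R) : UltraFilter G -> (forall t, `|f t| <= D) ->
  exists l : R, f @ G --> l.
Proof.
move=> GU fD; have GP := @ultra_proper _ _ GU.
have [|l [_ lcl]] := @segment_compact R (- D) D (f @ G) (fmap_proper_filter f GP).
  change (G (f @^-1` `[- D, D])).
  by apply: nearW => t; rewrite /preimage /= in_itv /= -ler_norml.
exists l => B Bl.
have [//|nB] := in_ultra_setVsetC (f @^-1` B) GU.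
by have [x []] := lcl (~` B) B nB Bl.
Qed.

Lemma geometric_small (R : realType) (z B e : R) : `|z| < 1 -> 0 < e ->
  exists k, B * z ^+ k <= e.
Proof.
move=> z1 e0.
have /cvgr0_norm_le /(_ _ e0) /filter_ex[k /= kP] := cvg_geometric B z1.
by exists k; apply: le_trans (ler_norm _) kP.
Qed.

(** * Additive eigenvalues of monotone maps *)

Section AdditiveEigenvalue.
Variables (R : realType) (d N : nat).
Hypotheses (d_gt0 : (0 < d)%N) (N_gt0 : (0 < N)%N).
Variables (r : R).
Hypothesis (r_ge0 : 0 <= r).
Notation idx := 'rV[int]_d.
Notation X := (Xdelta N r : set (idx -> R)).
Implicit Types (m n : idx) (v w : idx -> R).

Lemma XdeltaP v : X v <-> odd_periodic N v /\ forall m j, on_Geven m ->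
  `|(v (m + ibasis j) - v (m - ibasis j)) / (2 * hstep R N)| <= r.
Proof.
split=> -[vp vr]; split => // m.
  by move=> j /vr/(mx_norm_leP _ r_ge0)/(_ j); rewrite mxE.
by move=> em; apply/(mx_norm_leP _ r_ge0) => j; rewrite mxE; exact: vr.
Qed.

Lemma Xdelta_periodic v : X v -> odd_periodic N v.
Proof. by case. Qed.

Lemma Xdelta0 : X (fun=> 0).
Proof. by apply/XdeltaP; split => // m j _; rewrite subrr mul0r normr0. Qed.

Lemma Xdelta_scale (a : R) v : 0 <= a <= 1 -> X v -> X (fun m => a * v m).
Proof.
move=> /andP[a0 a1] /XdeltaP[vp vr]; apply/XdeltaP; split => [m j om|m j em].
  by rewrite vp.
rewrite -mulrBr -mulrA normrM (ger0_norm a0) -[r]mul1r.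
by apply: ler_pM => //; exact: vr.
Qed.

Lemma Xdelta_addr (a : R) v : X v -> X (fun m => v m + a).
Proof.
move=> /XdeltaP[vp vr]; apply/XdeltaP; split => [m j om|m j em].
  by rewrite vp.
by rewrite opprD addrACA subrr addr0; exact: vr.
Qed.

Lemma Xdelta_closed (T : Type) (G : set_system T) (w : T -> idx -> R) v :
  ProperFilter G -> (forall t, X (w t)) ->
  (forall m, on_Godd m -> w ^~ m @ G --> v m) -> X v.
Proof.
move=> GP wX wv; apply/XdeltaP; split => [m j om|m j em].
  have om' : on_Godd (m + ibasis j *+ (2 * N)) by rewrite on_Godd_shift.
  have := wv _ om'.
  have -> : w ^~ (m + ibasis j *+ (2 * N)) = w ^~ m.
    by apply: funext => t; rewrite (Xdelta_periodic (wX t)).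
  by move=> /cvg_unique; apply => //; exact: wv.
have o1 : on_Godd (m + ibasis j) by rewrite /on_Godd on_GevenD em on_Geven_ibasis.
have o2 : on_Godd (m - ibasis j).
  by rewrite /on_Godd on_GevenD em on_GevenN on_Geven_ibasis.
have FG : Filter G := GP.
have H : (fun t => (w t (m + ibasis j) - w t (m - ibasis j)) / (2 * hstep R N)) @ G
    --> (v (m + ibasis j) - v (m - ibasis j)) / (2 * hstep R N).
  by apply: cvgM; [apply: cvgB; exact: wv|exact: cvg_cst].
have {}H := @cvg_norm _ _ _ _ FG _ _ H.
apply: (cvgr_to_le H); apply: nearW => t /=.
by have /XdeltaP[_] := wX t; exact.
Qed.

Variable S : (idx -> R) -> idx -> R.
Hypothesis S_Xdelta : forall v, X v -> X (S v).
Hypothesis S_addr : forall v a m, S (fun n => v n + a) m = S v m + a.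
Hypothesis S_le : forall v w, X v -> X w ->
  (forall m, on_Godd m -> v m <= w m) -> forall m, on_Godd m -> S v m <= S w m.

Lemma S_le_addr v w (a : R) : X v -> X w ->
  (forall m, on_Godd m -> v m <= w m + a) ->
  forall m, on_Godd m -> S v m <= S w m + a.
Proof.
by move=> Xv Xw vw m om; rewrite -S_addr; apply: S_le => //; exact: Xdelta_addr.
Qed.

(** Monotonicity and commutation with constants give nonexpansiveness for the
    sup norm. *)
Lemma S_nonexpansive v w (e : R) : X v -> X w ->
  (forall m, on_Godd m -> `|v m - w m| <= e) ->
  forall m, on_Godd m -> `|S v m - S w m| <= e.
Proof.
move=> Xv Xw vw m om; rewrite ler_distl; apply/andP; split.
  rewrite lerBlDr; apply: S_le_addr => // n on.
  by have := vw n on; rewrite ler_distl lerBlDr => /andP[].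
by apply: S_le_addr => // n on; have := vw n on; rewrite ler_distl => /andP[].
Qed.

(** Compare the two equations at a maximum point of [w - v]. *)
Lemma eigenvalue_unique v w (a b : R) : X v -> X w ->
  (forall m, on_Godd m -> S v m + a = v m) ->
  (forall m, on_Godd m -> S w m + b = w m) -> a = b.
Proof.
have le v' w' (a' b' : R) : X v' -> X w' ->
    (forall m, on_Godd m -> S v' m + a' = v' m) ->
    (forall m, on_Godd m -> S w' m + b' = w' m) -> a' <= b'.
  move=> Xv Xw va wb.
  have per : odd_periodic N (fun m => w' m - v' m).
    by move=> m j om; rewrite !(Xdelta_periodic _ j om).
  have [t [ot tmax]] := odd_argmax N_gt0 d_gt0 per.
  have : S w' (rep t) <= S v' (rep t) + (w' (rep t) - v' (rep t)).
    by apply: S_le_addr => // m om; rewrite -lerBlDl tmax.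
  by have := va _ ot; have := wb _ ot; lra.
by move=> Xv Xw va wb; apply/eqP; rewrite eq_le (le v w)// (le w v).
Qed.

(** Vanishing discount: [v |-> (1 - e) * S v] contracts with ratio [1 - e], so
    its iterates from [0] are approximate fixed points. They may be as large
    as [B / e], but [e * v] stays bounded. *)
Lemma discounted_approx (B e : R) : 0 < e -> e < 1 ->
  (forall m, on_Godd m -> `|S (fun=> 0) m| <= B) ->
  exists v, [/\ X v, forall m, on_Godd m -> e * `|v m| <= B &
    forall m, on_Godd m -> `|(1 - e) * S v m - v m| <= e].
Proof.
move=> e0 e1 SB.
pose T v m := (1 - e) * S v m; pose y k := iter k T (fun=> 0).
have e01 : 0 <= 1 - e <= 1 by lra.
have yX k : X (y k).
  elim: k => [|k IH] /=; first exact: Xdelta0.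
  by apply: Xdelta_scale => //; exact: S_Xdelta.
have y_bound k m : on_Godd m -> e * `|y k m| <= B.
  elim: k m => [|k IH] m om /=.
    by rewrite normr0 mulr0; exact: le_trans (SB _ om).
  have : `|S (y k) m - S (fun=> 0) m| <= B / e.
    apply: S_nonexpansive (om) => //; first exact: Xdelta0.
    by move=> n on; rewrite subr0 ler_pdivlMr// mulrC IH.
  rewrite ler_pdivlMr// => H1.
  rewrite /T normrM ger0_norm; last by lra.
  have H2 := SB _ om.
  have H3 := ler_normD (S (y k) m - S (fun=> 0) m) (S (fun=> 0) m).
  rewrite subrK in H3.
  have B0 : 0 <= B by apply: le_trans H2.
  have H4 : e * `|S (y k) m| <= (1 + e) * B by nra.
  have H5 : (1 - e) * (e * `|S (y k) m|) <= (1 - e) * ((1 + e) * B).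
    by apply: ler_wpM2l => //; lra.
  rewrite mulrCA (le_trans H5)// mulrA -subr_sqr expr1n mulrBl mul1r gerBl.
  by rewrite mulr_ge0// sqr_ge0.
have step k m : on_Godd m -> `|y k.+1 m - y k m| <= B * (1 - e) ^+ k.
  elim: k m => [|k IH] m om.
    rewrite expr0 mulr1 /= subr0 /T normrM ger0_norm; last by lra.
    by have := SB _ om; have := normr_ge0 (S (fun=> 0) m); nra.
  rewrite -[y k.+2]/(T (y k.+1)) -[X in _ - X]/(T (y k) m) /T -mulrBr normrM.
  rewrite ger0_norm; last by lra.
  rewrite exprS mulrCA ler_wpM2l//; first by lra.
  exact: (S_nonexpansive (yX k.+1) (yX k) IH).
have [|k kP] := @geometric_small R (1 - e) B e _ e0.
  by rewrite ger0_norm; lra.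
exists (y k); split => // [m|m om]; first exact: y_bound.
exact: le_trans (step k m om) kP.
Qed.

(** This is what prevents differences between grid points from diverging when
    the discount vanishes. *)
Hypothesis S_harnack : forall C : R, exists D : R, forall v, X v ->
  (forall m, on_Godd m -> v m <= S v m + C) ->
  forall m m', on_Godd m -> on_Godd m' -> v m - v m' <= D.

(** A discounted solution [v] is a subsolution up to the constant [2 * B + 2],
    hence has oscillation at most [D] whatever the discount, and [S v - v] is
    constant up to the discount times this oscillation; then normalise by the
    value at [m0]. *)
Lemma eigenvector_approx m0 : on_Godd m0 -> exists D : R, forall e : R,
  0 < e -> exists v, [/\ X v, forall m, on_Godd m -> `|v m| <= D &
    forall m, on_Godd m -> `|(S v m - v m) - (S v m0 - v m0)| <= e].
Proof.
move=> om0.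
have [B SB] := odd_bounded N_gt0 (Xdelta_periodic (S_Xdelta Xdelta0)).
have [D HD] := S_harnack (2 * B + 2).
exists `|D| => e e0.
(* The discount makes the final error, at most [eta * (2 * `|D| + 4)], small;
   the bound 1/2 controls the division by [1 - eta]. *)
pose eta := Num.min (2^-1) (e / (2 * `|D| + 4)).
have K0 : 0 < 2 * `|D| + 4 by rewrite ltr_wpDl// mulr_ge0.
have eta0 : 0 < eta by rewrite lt_min invr_gt0 ltr0n divr_gt0.
have eta1 : eta <= 2^-1 by rewrite /eta ge_min lexx.
have etae : eta * (2 * `|D| + 4) <= e by rewrite -ler_pdivlMr// /eta ge_min lexx orbT.
have [v [Xv vB Sv]] := @discounted_approx B eta eta0 ltac:(lra) SB.
have Sv2 m : on_Godd m -> `|S v m - v m| <= 2 * B + 2.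
  move=> om; have := Sv m om; have := vB m om.
  rewrite -{1}(ger0_norm (ltW eta0)) -normrM.
  rewrite !ler_norml => /andP[? ?] /andP[? ?]; apply/andP; split; nra.
have osc m m' : on_Godd m -> on_Godd m' -> `|v m - v m'| <= `|D|.
  have H := HD v Xv; move=> om om'.
  have {}H k k' : on_Godd k -> on_Godd k' -> v k - v k' <= `|D|.
    move=> ok ok'; apply: le_trans (ler_norm D); apply: H => // n on.
    by have := Sv2 n on; rewrite ler_norml => /andP[]; lra.
  by rewrite ler_norml lerNl opprB !H.
exists (fun n => v n + - v m0); split => [|m om|m om].
- exact: Xdelta_addr.
- exact: osc.
- rewrite !S_addr.
  have := osc m m0 om om0; have := Sv m om; have := Sv m0 om0.
  rewrite !ler_norml => /andP[? ?] /andP[? ?] /andP[? ?]; apply/andP; split; nra.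
Qed.

(** Normalised approximate eigenvectors are bounded by a common [D], so they
    converge pointwise along an ultrafilter; on the odd grid convergence is
    uniform by periodicity, and [S] passes to the limit by nonexpansiveness. *)
Lemma eigenvalue_exists : exists (a : R) v, X v /\
  forall m, on_Godd m -> S v m + a = v m.
Proof.
pose m0 : idx := ibasis (Ordinal d_gt0).
have om0 : on_Godd m0 by rewrite /on_Godd on_Geven_ibasis.
have [D approx] := eigenvector_approx om0.
have /choice[w wP] (k : nat) := approx (harmonic k) (harmonic_gt0 k).
have [G [GU sG]] := ultraFilterLemma (F := \oo) _.
have GP := @ultra_proper _ _ GU.
have lim m : exists l : R, on_Godd m -> w ^~ m @ G --> l.
  case: (boolP (on_Godd m)) => [om|/negP nm]; last by exists 0.
  have [|l lP] := @bounded_ultra_cvg R nat G D (w ^~ m) GU.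
    by move=> k; have [_ /(_ m om)] := wP k.
  by exists l.
have [v vP] := choice lim.
have Xw k : X (w k) by have [] := wP k.
have Xv : X v by exact: (Xdelta_closed GP Xw).
have unif (e : R) : 0 < e ->
    \forall k \near G, forall m, on_Godd m -> `|v m - w k m| <= e.
  move=> e0.
  have : \forall k \near G, forall t : residue d N,
      on_Godd (rep t) -> `|v (rep t) - w k (rep t)| <= e.
    apply: filter_forall => t; case: (boolP (on_Godd (rep t))) => [om|nm].
      by have /cvgrPdist_le/(_ _ e0) := vP _ om; apply: filterS.
    by apply: nearW.
  apply: filterS => k kP m om.
  have [t ot tP] := odd_periodic_rep N_gt0 om.
  by rewrite (tP _ v (Xdelta_periodic Xv)) (tP _ (w k) (Xdelta_periodic (Xw k))) kP.
have small : (harmonic : R^nat) @ G --> (0 : R).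
  by apply: cvg_trans (@cvg_harmonic R); exact: cvg_app.
exists (v m0 - S v m0), v; split => // m om.
(* Four errors of replacing [v] by [w k], at [m] and at [m0], and the error of
   the approximate equation for [w k]: hence [e / 5]. *)
suff : `|(S v m - v m) - (S v m0 - v m0)| <= 0.
  by rewrite normr_le0 => /eqP; lra.
apply/ler_addgt0Pl => e e0; rewrite addr0.
have e5 : 0 < e / 5 by lra.
have /cvgr0Pnorm_le/(_ _ e5) small5 := small.
have [k [k1 k2]] := filter_ex (filterI (unif _ e5) small5).
have [_ _ /(_ m om) k3] := wP k.
have k4 := S_nonexpansive Xv (Xw k) k1.
have := k4 _ om; have := k4 _ om0; have := k1 _ om; have := k1 _ om0.
have {}k2 : harmonic k <= e / 5 := le_trans (ler_norm _) k2.
move: (harmonic k) k2 k3 => hk k2; rewrite !ler_norml.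
do 5 move=> /andP[? ?]; apply/andP; split; lra.
Qed.

End AdditiveEigenvalue.

Theorem theorem3p1 (R : realType) (d : nat) (d_gt0 : (0 < d)%N)
  (L : 'rV[R]_d -> R -> 'rV[R]_d -> R)
  (L_periodic : torus_periodic L)
  (L_C2 : jointly_C2 L)
  (L_convex : forall x t z, positive_definite (hessian (L x t) z))
  (L_superlinear : superlinear L)
  (L_x_bound : x_derivative_bound L)
  (P : set 'rV[R]_d)
  (P_compact : compact P)
  (P_convex : convex_set (P : set (convex_lmodType 'rV[R]_d)))
  (r : R) (r_gt0 : 0 < r)
  (N K : nat) (N_gt0 : (0 < N)%N) (K_gt0 : (0 < K)%N)
  (lambda1 : R) (lambda1_gt0 : 0 < lambda1)
  (lambda_lt : lambda R N K < lambda1)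
  (phi_invariant : time1_invariant N K L P r)
  (phi_speed : speed_bound N K L P r lambda1)
  (phi_representation : stochastic_representation N K L P r) :
  forall c, P c ->
    exists! Hbar : R,
      exists2 vbar : 'rV[int]_d -> R, Xdelta N r vbar &
        forall m, on_Godd m -> time1_map N K L c vbar m + Hbar = vbar m.
Proof.
move=> c Pc.
have r_ge0 := ltW r_gt0.
have S_le := time1_map_le d_gt0 N_gt0 K_gt0 phi_representation Pc.
have S_addr := time1_map_addr N K d_gt0 L c.
have [|a [v [Xv va]]] := eigenvalue_exists d_gt0 N_gt0 r_ge0
    (phi_invariant c ^~ Pc) S_addr S_le.
  move=> C.
  have [D HD] := harnack d_gt0 N_gt0 K_gt0 c C L_periodic L_superlinear.
  by exists D => v Xv; apply: HD; exact: (Xdelta_periodic Xv).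
exists a; split; first by exists v.
move=> b [w Xw wb].
exact: (eigenvalue_unique d_gt0 N_gt0 r_ge0 S_addr S_le Xv Xw va wb).
Qed.
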